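(* Let $\mathbf H(s)=\sum_{l=1}^n\frac{\gamma_l}{s-\pi_l}$ with mutually distinct poles $\pi_1,\dots,\pi_n\in\mathbb C$ and nonzero residues $\gamma_1,\dots,\gamma_n\in\mathbb C$, and let $\mathbb L,\mathbb L_s\in\mathbb C^{q\times k}$ be the associated Loewner and shifted Loewner matrices built from left points $\mu_1,\dots,\mu_q$ and right points $\lambda_1,\dots,\lambda_k$, $q,k\ge n$ (as in the context). For $1\le i\le n$ let $$\rho_i=\frac1{|\gamma_i|}\,\|\mathbf p_i\|_2\left(|\pi_i|\,\|\mathbb L\|_2+\|\mathbb L_s\|_2\right)\|\mathbf q_i\|_2,\qquad \mathbf q_i=(\mathcal C_{\lambda,\pi}^T)^+\mathbf e_i,\quad \mathbf p_i=(\mathcal C_{\mu,\pi}^T)^+\mathbf e_i,$$ be the sensitivity of the eigenvalue $\pi_i$ of the Loewner pencil $(\mathbb L_s,\mathbb L)$ with respect to unstructured perturbations. Then, for all $1\le i\le n$, $$\rho_i\le\zeta_i\,\kappa(\mathcal C_{\mu,\pi})\,\kappa(\mathcal C_{\lambda,\pi}),\qquad \zeta_i=\frac1{|\gamma_i|}\left(|\pi_i|\max_j|\gamma_j|+\max_j|\pi_j\gamma_j|\right).$$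
   Context: The points $\mu_1,\dots,\mu_q,\lambda_1,\dots,\lambda_k\in\mathbb C$ are pairwise distinct and different from the poles. Put $\mathbf v_i=\mathbf H(\mu_i)$, $\mathbf w_j=\mathbf H(\lambda_j)$, and $$(\mathbb L)_{i,j}=\frac{\mathbf v_i-\mathbf w_j}{\mu_i-\lambda_j},\qquad(\mathbb L_s)_{i,j}=\frac{\mu_i\mathbf v_i-\mathbf w_j\lambda_j}{\mu_i-\lambda_j}.$$ For $\alpha=(\alpha_1,\dots,\alpha_\kappa)$ and $\beta=(\beta_1,\dots,\beta_\rho)$, the Cauchy matrix $\mathcal C_{\alpha,\beta}\in\mathbb C^{\kappa\times\rho}$ has entries $(\mathcal C_{\alpha,\beta})_{i,j}=\frac1{\alpha_i-\beta_j}$. $(\cdot)^T$ is the transpose without conjugation, $(\cdot)^+$ the Moore-Penrose generalized inverse, $\mathbf e_i$ the $i$-th unit vector of length $n$, $\|\cdot\|_2$ the Euclidean norm of vectors and the spectral norm of matrices, and $\kappa(\mathbf X)=\|\mathbf X\|_2\|\mathbf X^+\|_2$ the condition number of a matrix $\mathbf X$. *)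

(* Defs.v *)
From HB Require Import structures.
From mathcomp Require Import all_boot all_order all_algebra.
From mathcomp Require Import all_classical all_reals.
From mathcomp Require Export complex.

Set Implicit Arguments.
Unset Strict Implicit.
Unset Printing Implicit Defensive.

Import Order.TTheory GRing.Theory Num.Theory.
Import ComplexField.
Local Open Scope ring_scope.
Local Open Scope complex_scope.
Local Open Scope sesquilinear_scope.
Local Open Scope classical_set_scope.

Section MoorePenrose.
Variable C : numClosedFieldType.

(* The four Penrose equations; [^t*] is the conjugate transpose. *)
Definition penrose m n (A : 'M[C]_(m, n)) (X : 'M[C]_(n, m)) : Prop :=
  [/\ A *m X *m A = A, X *m A *m X = X,
      (A *m X) ^t* = A *m X & (X *m A) ^t* = X *m A].

(* Well defined, by [mpinvP] and [penrose_unique] below. *)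
Definition mpinv m n (A : 'M[C]_(m, n)) : 'M[C]_(n, m) :=
  xget 0 [set X | penrose A X].

Lemma adjM m n p (A : 'M[C]_(m, n)) (B : 'M[C]_(n, p)) :
  (A *m B) ^t* = B ^t* *m A ^t*.
Proof. by rewrite trmx_mul map_mxM. Qed.

Lemma gram_unit r n (B : 'M[C]_(r, n)) : row_free B -> B *m B ^t* \in unitmx.
Proof.
move=> freeB; rewrite -row_free_unit; apply: inj_row_free => v vG0.
set w := v *m B.
have: w *m w ^t* = 0 by rewrite /w adjM mulmxA -(mulmxA v) vG0 mul0mx.
move=> /matrixP/(_ 0 0); rewrite [LHS]mxE [RHS]mxE.
under eq_bigr => j _ do rewrite [X in _ * X]mxE [X in _ * (_ X)]mxE -normCK.
move=> /eqP; rewrite psumr_eq0 => [/allP s0|j _]; last by rewrite exprn_ge0.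
apply: (row_free_inj freeB); rewrite -/w mul0mx; apply/rowP => j.
have := s0 j (mem_index_enum _).
by rewrite /= expf_eq0 /= normr_eq0 => /eqP ->; rewrite mxE.
Qed.

Lemma penrose_exists m n (A : 'M[C]_(m, n)) : exists X, penrose A X.
Proof.
have := mulmx_base A; have := row_base_free A; have := col_base_full A.
move: (col_base A) (row_base A) => P Q fullP freeQ.
move: (\rank A) P Q fullP freeQ => r P Q fullP freeQ defA.
set G := P ^t* *m P; set K := Q *m Q ^t*.
have uK : K \in unitmx by exact: gram_unit.
have uG : G \in unitmx.
  rewrite /G -{2}(trmxCK P) gram_unit //.
  by rewrite /row_free mxrank_map mxrank_tr; exact: fullP.
have Gh : G ^t* = G by rewrite adjM trmxCK.
have Kh : K ^t* = K by rewrite adjM trmxCK.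
have iGh : (invmx G) ^t* = invmx G by rewrite trmx_inv map_invmx Gh.
have iKh : (invmx K) ^t* = invmx K by rewrite trmx_inv map_invmx Kh.
pose X := Q ^t* *m invmx K *m (invmx G *m P ^t*).
have AX : A *m X = P *m invmx G *m P ^t*.
  rewrite -defA /X -!mulmxA (mulmxA Q (Q ^t*)) -/K.
  by rewrite (mulmxA K) mulmxV // mul1mx.
have XA : X *m A = Q ^t* *m invmx K *m Q.
  rewrite -defA /X -!mulmxA (mulmxA (P ^t*) P Q) -/G.
  by rewrite (mulmxA (invmx G)) mulVmx // mul1mx.
exists X; split.
- by rewrite AX -defA -!mulmxA (mulmxA (P ^t*)) -/G mulKmx.
- by rewrite XA /X -!mulmxA (mulmxA Q (Q ^t*)) -/K mulKmx.
- by rewrite AX !adjM trmxCK iGh mulmxA.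
- by rewrite XA !adjM trmxCK iKh mulmxA.
Qed.

Lemma mpinvP m n (A : 'M[C]_(m, n)) : penrose A (mpinv A).
Proof. by have [X AX] := penrose_exists A; apply: (xgetPex 0); exists X. Qed.

Lemma penrose_unique m n (A : 'M[C]_(m, n)) X Y :
  penrose A X -> penrose A Y -> X = Y.
Proof.
move=> [X1 X2 X3 X4] [Y1 Y2 Y3 Y4].
have e1 : A *m X = A *m Y.
  by rewrite -X3 -[in LHS]Y1 -(mulmxA _ A X) adjM X3 Y3 mulmxA X1.
have e2 : X *m A = Y *m A.
  by rewrite -X4 -[in LHS]Y1 -(mulmxA A) mulmxA adjM X4 Y4 -mulmxA (mulmxA A) X1.
by rewrite -X2 -mulmxA e1 mulmxA e2 Y2.
Qed.

End MoorePenrose.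

Section Norms.
Variable R : realType.

(* The modulus is the [R]-valued [normc]; the generic [`|z|] lands in [R[i]]. *)
Definition norm2 n (x : 'cV[R[i]]_n) : R :=
  Num.sqrt (\sum_(j < n) Normc.normc (x j 0) ^+ 2).

(* Spectral norm: the operator norm induced by the Euclidean norms. The set is
   nonempty (it contains 0) and bounded, so [sup] is a genuine supremum. *)
Definition specnorm m n (A : 'M[R[i]]_(m, n)) : R :=
  sup [set norm2 (A *m x) | x in [set x : 'cV[R[i]]_n | norm2 x <= 1]].

Definition condnum m n (A : 'M[R[i]]_(m, n)) : R :=
  specnorm A * specnorm (mpinv A).

End Norms.

Section Loewner.
Variable R : realType.
Notation C := R[i].

Definition cauchy m n (a : 'I_m -> C) (b : 'I_n -> C) : 'M[C]_(m, n) :=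
  \matrix_(i, j) (a i - b j)^-1.

Definition transfer n (gamma p : 'I_n -> C) (s : C) : C :=
  \sum_(l < n) gamma l / (s - p l).

Definition loewner q k (H : C -> C) (mu : 'I_q -> C) (lambda : 'I_k -> C)
    : 'M[C]_(q, k) :=
  \matrix_(i, j) ((H (mu i) - H (lambda j)) / (mu i - lambda j)).

Definition sloewner q k (H : C -> C) (mu : 'I_q -> C) (lambda : 'I_k -> C)
    : 'M[C]_(q, k) :=
  \matrix_(i, j)
    ((mu i * H (mu i) - H (lambda j) * lambda j) / (mu i - lambda j)).

(* (C_{a,p}^T)^+ e_i : the vector q_i for [a := lambda], p_i for [a := mu]. *)
Definition dualvec m n (a : 'I_m -> C) (p : 'I_n -> C) (i : 'I_n) : 'cV[C]_m :=
  mpinv ((cauchy a p)^T) *m delta_mx i 0.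

Definition sensitivity n q k (gamma p : 'I_n -> C) (mu : 'I_q -> C)
    (lambda : 'I_k -> C) (i : 'I_n) : R :=
  let H := transfer gamma p in
  (Normc.normc (gamma i))^-1 * norm2 (dualvec mu p i) *
  (Normc.normc (p i) * specnorm (loewner H mu lambda)
   + specnorm (sloewner H mu lambda)) *
  norm2 (dualvec lambda p i).

(* The maxima are over the nonempty ['I_n] and of nonnegative reals, so the
   default value 0 is harmless. *)
Definition zeta n (gamma p : 'I_n -> C) (i : 'I_n) : R :=
  (Normc.normc (gamma i))^-1 *
  (Normc.normc (p i) * \big[Num.max/0]_(j < n) Normc.normc (gamma j)
   + \big[Num.max/0]_(j < n) Normc.normc (p j * gamma j)).

End Loewner.

(* Main.v *)
Require Import Defs.
From mathcomp Require Import all_boot all_order all_algebra.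
From mathcomp Require Import all_classical all_reals.
From mathcomp Require Import ring lra.
Import Order.TTheory GRing.Theory Num.Theory.
Local Open Scope ring_scope.
Local Open Scope complex_scope.

Set Implicit Arguments.
Unset Strict Implicit.
Unset Printing Implicit Defensive.

(** Partial fractions factor both Loewner matrices through Cauchy matrices:
    subtracting the terms of the pole [p l] at [mu i] and [lambda j] and dividing
    by [mu i - lambda j] leaves
    [- gamma l / ((mu i - p l) (lambda j - p l))], with an extra factor [p l] in
    the shifted case. So L and L_s have the form
    [cauchy mu p *m D *m (cauchy lambda p)^T] with D diagonal
    ([loewner_factor], [sloewner_factor]). The spectral norm is submultiplicative
    and invariant under transposition, and that of D is at most the largest
    modulus of its entries, which bounds [|p i| * |L| + |L_s|] by
    [|gamma i| * zeta_i] times the norms of the two Cauchy matrices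
    ([specnorm_factor_le]).

    The vectors [dualvec mu p i] and [dualvec lambda p i] are images of unit
    vectors under pseudoinverses of transposed Cauchy matrices. Pseudoinversion
    commutes with transposition ([mpinv_tr]), so their norms are at most those of
    the pseudoinverses of the Cauchy matrices ([norm2_dualvec_le]); these supply
    the second factors of the two condition numbers.

    The transposes here are plain ones, so the Cauchy-Schwarz inequality is used
    in a bilinear form ([normc_dot_le]), and conjugation enters the norm estimates
    only through the identity [y^T y^* = |y|^2] ([dot_conj]), where [y^*] is the
    entrywise conjugate of [y]. *)

(** * The Euclidean norm and the Cauchy-Schwarz inequality *)

(** Lagrange's identity: the difference of the two sides is half the double sum
    of [(x i * y j - x j * y i) ^+ 2]; the proof compares the double sums term by
    term after doubling. *)
Lemma sqr_sum_mul_le (R : realFieldType) n (x y : 'I_n -> R) :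
  (\sum_i x i * y i) ^+ 2 <= (\sum_i x i ^+ 2) * (\sum_i y i ^+ 2).
Proof.
have dbl (f g : 'I_n -> R) :
    (\sum_i f i) * (\sum_j g j) = \sum_i \sum_j f i * g j.
  by rewrite mulr_suml; apply: eq_bigr => i _; rewrite mulr_sumr.
(* One of the two copies of the right-hand side has its factors swapped, so that
   the terms at (i, j) add up to x_i^2 y_j^2 + y_i^2 x_j^2. *)
rewrite -(ler_pM2r (ltr0n R 2)) !mulr_natr.
rewrite [leRHS]mulr2n {2}[(\sum_i x i ^+ 2) * _]mulrC expr2 !dbl -big_split.
rewrite -sumrMnl; apply: ler_sum => i _ /=.
rewrite -big_split -sumrMnl; apply: ler_sum => j _ /=.
have := sqr_ge0 (x i * y j - y i * x j); nra.
Qed.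

Section Norm2.
Variable R : realType.
Notation C := R[i].
Notation normc := (@Normc.normc R).

Lemma normc_ge0 (z : C) : 0 <= normc z.
Proof. by case: z => a b; rewrite sqrtr_ge0. Qed.

Lemma normc_real (r : R) : 0 <= r -> normc r%:C = r.
Proof. by move=> r0; rewrite /= expr0n /= addr0 sqrtr_sqr ger0_norm. Qed.

Lemma normc_conj (z : C) : normc z^*%C = normc z.
Proof. by case: z => a b; rewrite /= sqrrN. Qed.

Lemma mul_conjc_normc (z : C) : z * z^*%C = (normc z ^+ 2)%:C.
Proof. by rewrite -sqr_normc rmorphXn. Qed.

Lemma le_normc_sum (n : nat) (f : 'I_n -> C) :
  normc (\sum_i f i) <= \sum_i normc (f i).
Proof.
apply: (big_ind2 (fun z r => normc z <= r)) => //; first by rewrite Normc.normc0.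
by move=> z a w b za wb; apply: le_trans (le_normcD z w) (lerD za wb).
Qed.

Lemma norm2_ge0 n (x : 'cV[C]_n) : 0 <= norm2 x.
Proof. exact: sqrtr_ge0. Qed.

Lemma norm2_sqr n (x : 'cV[C]_n) : norm2 x ^+ 2 = \sum_j normc (x j 0) ^+ 2.
Proof. by rewrite sqr_sqrtr // sumr_ge0 // => j _; rewrite sqr_ge0. Qed.

Lemma norm2_0 n : norm2 (0 : 'cV[C]_n) = 0.
Proof.
by rewrite /norm2 big1 ?sqrtr0 // => j _; rewrite mxE Normc.normc0 expr0n.
Qed.

Lemma norm2Z n (c : C) (x : 'cV[C]_n) : norm2 (c *: x) = normc c * norm2 x.
Proof.
apply: (@pexpIrn _ 2) => //; rewrite ?nnegrE ?mulr_ge0 ?norm2_ge0 ?normc_ge0 //.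
rewrite exprMn !norm2_sqr mulr_sumr; apply: eq_bigr => j _.
by rewrite mxE Normc.normcM exprMn.
Qed.

Lemma norm2_conj n (x : 'cV[C]_n) : norm2 (map_mx conjc x) = norm2 x.
Proof. by congr Num.sqrt; apply: eq_bigr => j _; rewrite mxE normc_conj. Qed.

Lemma norm2_unit n (i : 'I_n) : norm2 (delta_mx i 0 : 'cV[C]_n) = 1.
Proof.
rewrite /norm2 (bigD1 i) //= big1 => [|j ji].
  by rewrite mxE !eqxx Normc.normc1 expr1n addr0 sqrtr1.
by rewrite mxE (negPf ji) Normc.normc0 expr0n.
Qed.

Lemma normc_dot_le n (x y : 'cV[C]_n) :
  normc ((x^T *m y) 0 0) <= norm2 x * norm2 y.
Proof.
rewrite -(@ler_pXn2r _ 2) // ?nnegrE ?mulr_ge0 ?norm2_ge0 ?normc_ge0 //.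
rewrite exprMn !norm2_sqr.
apply: le_trans (sqr_sum_mul_le (fun j => normc (x j 0)) (fun j => normc (y j 0))).
have s0 : 0 <= \sum_j normc (x j 0) * normc (y j 0).
  by apply: sumr_ge0 => j _; rewrite mulr_ge0 ?normc_ge0.
rewrite ler_pXn2r // ?nnegrE ?normc_ge0 // mxE.
apply: le_trans (le_normc_sum _) _.
by apply: ler_sum => j _; rewrite mxE Normc.normcM.
Qed.

Lemma dot_conj n (x : 'cV[C]_n) :
  (x^T *m map_mx conjc x) 0 0 = (norm2 x ^+ 2)%:C.
Proof.
rewrite norm2_sqr rmorph_sum mxE; apply: eq_bigr => j _ /=.
by rewrite !mxE mul_conjc_normc.
Qed.

End Norm2.

(** * The spectral norm *)

Section SpectralNorm.
Variable R : realType.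
Notation C := R[i].
Notation normc := (@Normc.normc R).

(** Cauchy-Schwarz on each row makes the Frobenius norm an admissible constant.
    This bounds the set whose supremum is the spectral norm; without it [sup]
    would take its default value. *)
Lemma norm2_mulmx_bounded m n (A : 'M[C]_(m, n)) :
  exists2 M : R, 0 <= M & forall x, norm2 (A *m x) <= M * norm2 x.
Proof.
pose S := \sum_i norm2 (row i A)^T ^+ 2.
have S0 : 0 <= S by apply: sumr_ge0 => i _; rewrite sqr_ge0.
exists (Num.sqrt S) => [|x]; first exact: sqrtr_ge0.
rewrite -(@ler_pXn2r _ 2) // ?nnegrE ?mulr_ge0 ?norm2_ge0 ?sqrtr_ge0 //.
rewrite exprMn (sqr_sqrtr S0) norm2_sqr mulr_suml; apply: ler_sum => i _.
rewrite -exprMn ler_pXn2r // ?nnegrE ?mulr_ge0 ?norm2_ge0 ?normc_ge0 //.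
by have := normc_dot_le (row i A)^T x; rewrite trmxK -row_mul mxE.
Qed.

Lemma norm2_mulmx_le m n (A : 'M[C]_(m, n)) x :
  norm2 (A *m x) <= specnorm A * norm2 x.
Proof.
have [M M0 AM] := norm2_mulmx_bounded A.
have [x0|x0] := eqVneq (norm2 x) 0.
  by have := AM x; rewrite x0 !mulr0.
have xp : 0 < norm2 x by rewrite lt_def x0 norm2_ge0.
have cE : normc (norm2 x)^-1%:C = (norm2 x)^-1.
  by rewrite normc_real // invr_ge0 norm2_ge0.
rewrite -ler_pdivrMr // mulrC -{1}cE -norm2Z scalemxAr.
apply: ub_le_sup.
  exists M => _ [y /= y1 <-]; apply: le_trans (AM y) _.
  by rewrite ler_piMr.
by exists ((norm2 x)^-1%:C *: x) => //=; rewrite norm2Z cE mulVf.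
Qed.

Lemma specnorm_ge0 m n (A : 'M[C]_(m, n)) : 0 <= specnorm A.
Proof.
have [M M0 AM] := norm2_mulmx_bounded A.
apply: ub_le_sup; last by exists 0; rewrite /= ?mulmx0 norm2_0.
exists M => _ [y /= y1 <-]; apply: le_trans (AM y) _.
by rewrite ler_piMr.
Qed.

Lemma specnorm_le m n (A : 'M[C]_(m, n)) (c : R) : 0 <= c ->
  (forall x, norm2 (A *m x) <= c * norm2 x) -> specnorm A <= c.
Proof.
move=> c0 Ac; apply: ge_sup; first by exists (norm2 (A *m 0)), 0; rewrite /= ?norm2_0.
by move=> _ [x /= x1 <-]; apply: le_trans (Ac x) _; rewrite ler_piMr.
Qed.

Lemma specnormM m n r (A : 'M[C]_(m, n)) (B : 'M[C]_(n, r)) :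
  specnorm (A *m B) <= specnorm A * specnorm B.
Proof.
apply: specnorm_le => [|x]; first by rewrite mulr_ge0 ?specnorm_ge0.
rewrite -mulmxA; apply: le_trans (norm2_mulmx_le _ _) _.
by rewrite -mulrA ler_wpM2l ?specnorm_ge0 ?norm2_mulmx_le.
Qed.

(** With [y = A^T x], the transpose moves across the product:
    [|y|^2 = y^T y^* = x^T A y^* <= |x| |A| |y|], and [|y|] cancels. *)
Lemma specnorm_tr_le m n (A : 'M[C]_(m, n)) : specnorm A^T <= specnorm A.
Proof.
apply: specnorm_le => [|x]; first exact: specnorm_ge0.
set y := A^T *m x.
have [->|y0] := eqVneq (norm2 y) 0; first by rewrite mulr_ge0 ?specnorm_ge0 ?norm2_ge0.
have yp : 0 < norm2 y by rewrite lt_def y0 norm2_ge0.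
rewrite -(ler_pM2r yp) -expr2 -[leLHS]normc_real ?sqr_ge0 // -dot_conj.
rewrite {1}/y trmx_mul trmxK -mulmxA; apply: le_trans (normc_dot_le _ _) _.
rewrite mulrAC [leRHS]mulrC ler_wpM2l ?norm2_ge0 //.
by rewrite -(norm2_conj y) norm2_mulmx_le.
Qed.

Lemma specnorm_tr m n (A : 'M[C]_(m, n)) : specnorm A^T = specnorm A.
Proof.
apply/le_anti; rewrite specnorm_tr_le /=.
by rewrite -{1}(trmxK A) specnorm_tr_le.
Qed.

Lemma specnorm_diag_le n (d : 'rV[C]_n) :
  specnorm (diag_mx d) <= \big[Num.max/0]_(j < n) normc (d 0 j).
Proof.
set M := \big[_/_]_j _.
have M0 : 0 <= M by apply: bigmax_ge_id.
apply: specnorm_le => // x.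
rewrite -(@ler_pXn2r _ 2) // ?nnegrE ?mulr_ge0 ?norm2_ge0 //.
rewrite exprMn !norm2_sqr mulr_sumr; apply: ler_sum => j _.
rewrite mul_diag_mx mxE Normc.normcM exprMn ler_wpM2r ?sqr_ge0 //.
by rewrite ler_pXn2r ?nnegrE ?normc_ge0 //; apply: le_bigmax.
Qed.

End SpectralNorm.

(** * Pseudoinverses and transposition *)

(** Transposition commutes with entrywise conjugation, so transposing the Penrose
    equations of A yields those of [A^T], with the two Hermitian conditions
    exchanged. *)
Lemma mpinv_tr (C : numClosedFieldType) m n (A : 'M[C]_(m, n)) :
  mpinv A^T = (mpinv A)^T.
Proof.
have [A1 A2 A3 A4] := mpinvP A.
apply: penrose_unique (mpinvP _) _.
split; rewrite -?trmx_mul ?mulmxA -?trmx_mul -?mulmxA ?A1 ?A2 //.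
- by rewrite mulmxA A1.
- by rewrite mulmxA A2.
- by rewrite -map_trmx A4.
- by rewrite -map_trmx A3.
Qed.

(** * Cauchy factorizations and the sensitivity bound *)

Section Sensitivity.
Variable R : realType.
Notation C := R[i].
Notation normc := (@Normc.normc R).

Lemma norm2_dualvec_le m n (a : 'I_m -> C) (p : 'I_n -> C) (i : 'I_n) :
  norm2 (dualvec a p i) <= specnorm (mpinv (cauchy a p)).
Proof.
apply: le_trans (norm2_mulmx_le _ _) _.
by rewrite norm2_unit mulr1 mpinv_tr specnorm_tr.
Qed.

Variables (n q k : nat) (gamma p : 'I_n -> C).
Variables (mu : 'I_q -> C) (lambda : 'I_k -> C).
Hypothesis mu_lambda : forall i j, mu i != lambda j.
Hypothesis mu_p : forall i l, mu i != p l.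
Hypothesis lambda_p : forall j l, lambda j != p l.

Lemma loewner_factor :
  loewner (transfer gamma p) mu lambda =
  cauchy mu p *m diag_mx (\row_l - gamma l) *m (cauchy lambda p)^T.
Proof.
apply/matrixP => i j; rewrite mxE [RHS]mxE /transfer -sumrB mulr_suml.
apply: eq_bigr => l _; rewrite mul_mx_diag !mxE.
field; rewrite !subr_eq0.
by rewrite ?mu_p ?lambda_p ?mu_lambda.
Qed.

Lemma sloewner_factor :
  sloewner (transfer gamma p) mu lambda =
  cauchy mu p *m diag_mx (\row_l - (p l * gamma l)) *m (cauchy lambda p)^T.
Proof.
apply/matrixP => i j; rewrite mxE [RHS]mxE /transfer.
rewrite mulr_sumr [X in _ - X]mulr_suml -sumrB mulr_suml.
apply: eq_bigr => l _; rewrite mul_mx_diag !mxE.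
field; rewrite !subr_eq0.
by rewrite ?mu_p ?lambda_p ?mu_lambda.
Qed.

Lemma specnorm_factor_le (d : 'I_n -> C) :
  specnorm (cauchy mu p *m diag_mx (\row_l - d l) *m (cauchy lambda p)^T) <=
  specnorm (cauchy mu p) * (\big[Num.max/0]_(j < n) normc (d j)) *
  specnorm (cauchy lambda p).
Proof.
apply: le_trans (specnormM _ _) _.
rewrite specnorm_tr ler_wpM2r ?specnorm_ge0 //.
apply: le_trans (specnormM _ _) _.
rewrite ler_wpM2l ?specnorm_ge0 //.
apply: le_trans (specnorm_diag_le _) _.
by under eq_bigr => j _ do rewrite mxE normcN.
Qed.

End Sensitivity.

Theorem mainTheorem7 (R : realType) (n q k : nat)
    (gamma p : 'I_n -> R[i]) (mu : 'I_q -> R[i]) (lambda : 'I_k -> R[i])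
    (p_inj : injective p)
    (gamma_neq0 : forall l, gamma l != 0)
    (mu_inj : injective mu) (lambda_inj : injective lambda)
    (mu_lambda : forall i j, mu i != lambda j)
    (mu_p : forall i l, mu i != p l)
    (lambda_p : forall j l, lambda j != p l)
    (n_le_q : (n <= q)%N) (n_le_k : (n <= k)%N) :
  forall i : 'I_n,
    sensitivity gamma p mu lambda i
      <= zeta gamma p i * condnum (cauchy mu p) * condnum (cauchy lambda p).
Proof.
move=> i; rewrite /sensitivity /zeta /condnum /=.
rewrite loewner_factor // sloewner_factor //.
set g := Normc.normc (gamma i); set a := Normc.normc (p i).
have a0 : 0 <= a by exact: normc_ge0.
have g0 : 0 <= g^-1 by rewrite invr_ge0 normc_ge0.
set G := \big[_/_]_j _; set P := \big[_/_]_j _.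
set cm := specnorm (cauchy mu p); set cl := specnorm (cauchy lambda p).
have L1 : specnorm _ <= cm * G * cl := specnorm_factor_le p mu lambda gamma.
have L2 : specnorm _ <= cm * P * cl :=
  specnorm_factor_le p mu lambda (fun l => p l * gamma l).
have mp := norm2_dualvec_le mu p i.
have lp := norm2_dualvec_le lambda p i.
set x := specnorm (mpinv (cauchy mu p)) in mp *.
set y := specnorm (mpinv (cauchy lambda p)) in lp *.
have -> : g^-1 * (a * G + P) * (cm * x) * (cl * y) =
  g^-1 * x * (a * (cm * G * cl) + cm * P * cl) * y by ring.
have S0 m r (A : 'M[R[i]]_(m, r)) := specnorm_ge0 A.
have N0 r (v : 'cV[R[i]]_r) := norm2_ge0 v.
apply: ler_pM => //; first by rewrite !(mulr_ge0, addr_ge0).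
apply: ler_pM; rewrite ?(mulr_ge0, addr_ge0) //.
  by rewrite ler_wpM2l.
by apply: lerD => //; rewrite ler_wpM2l.
Qed.
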